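(* Let $K=\mathbb{F}_q$ be a finite field with $q\neq 2$. If $G$ is a Hamiltonian bipartite graph and $X$ is the projective algebraic toric set parameterized by the edges of $G$ (defined in the context), then $${\rm reg}(S/I(X))\leq {\rm deg}(S/I(X))-{\rm codim}(S/I(X)).$$
   Context: Graphs are finite and simple. A graph is Hamiltonian if it contains a cycle passing through all its vertices. Let $G$ have vertex set $\{y_1,\ldots,y_n\}$ and edges $f_1,\ldots,f_s$, and let $v_i=e_j+e_k\in\{0,1\}^n$ be the characteristic vector of $f_i=\{y_j,y_k\}$. Put $K^*=K\setminus\{0\}$ and, for $x\in (K^* )^n$, $x^{v_i}=x_1^{v_{i1}}\cdots x_n^{v_{in}}$. The projective algebraic toric set parameterized by the edges of $G$ is $X=\{[(x^{v_1},\ldots,x^{v_s})] : x\in (K^* )^n\}\subset\mathbb{P}^{s-1}$, the projective space over $K$. $S=K[t_1,\ldots,t_s]$ is a polynomial ring with the standard grading, and $I(X)$ is the ideal of $S$ generated by the homogeneous polynomials vanishing on $X$. The Hilbert function is $H_X(d)=\dim_K (S/I(X))_d$; it is constant for $d\gg 0$, the constant being the degree ${\rm deg}(S/I(X))=|X|$. ${\rm reg}(S/I(X))$ is the least integer $p\geq 0$ such that $H_X(d)=|X|$ for all $d\geq p$ (this equals the Castelnuovo-Mumford regularity). ${\rm codim}(S/I(X))=\dim S-\dim S/I(X)$ (Krull dimensions). *)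

(* Defs.v *)
From HB Require Import structures.
From mathcomp Require Import all_boot all_order all_algebra.
From mathcomp Require Import boolp classical_sets.
From mathcomp Require Import mpoly.

Set Implicit Arguments.
Unset Strict Implicit.
Unset Printing Implicit Defensive.

Import GRing.Theory.

Local Open Scope ring_scope.
Local Open Scope quotient_scope.

(* Finite simple graphs with vertices 'I_n and edges listed, without
   repetition, as edge 0, ..., edge (s - 1). *)
Record sgraph (n s : nat) := SGraph {
  edge : 'I_s -> {set 'I_n};
  edge_inj : injective edge;
  edge_card2 : forall k, #|edge k| = 2
}.

Definition adjacent n s (G : sgraph n s) : rel 'I_n :=
  fun i j => [exists k, edge G k == [set i; j]%SET].

Definition bipartite n s (G : sgraph n s) : Prop :=
  exists A : {set 'I_n}, forall i j, adjacent G i j -> (i \in A) != (j \in A).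

(* [ucycle] accepts a closed walk back and forth along one edge, whence the
   bound on the size of the cycle. *)
Definition hamiltonian n s (G : sgraph n s) : Prop :=
  exists c : seq 'I_n,
    [/\ (2 < size c)%N, ucycle (adjacent G) c & forall i, i \in c].

Section ToricSet.
Variables (K : finFieldType) (n s : nat) (G : sgraph n s).

Definition edge_vector (k : 'I_s) (i : 'I_n) : nat := i \in edge G k.

Definition edge_monomials (x : 'rV[K]_n) : 'rV[K]_s :=
  \row_(k < s) \prod_(i < n) x 0 i ^+ edge_vector k i.

(* A point of the projective space over K is the equivalence class of a
   nonzero vector, i.e. the set of the nonzero multiples of this vector. *)
Definition proj_point (v : 'rV[K]_s) : {set 'rV[K]_s} :=
  [set a *: v | a in [pred a : K | a != 0]]%SET.

Definition toric_set : {set {set 'rV[K]_s}} :=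
  [set proj_point (edge_monomials x) |
     x : 'rV[K]_n in [pred x : 'rV[K]_n | [forall i, x 0 i != 0]]]%SET.

End ToricSet.

Definition ideal_gen (A : comNzRingType) (E : set A) : {pred A} :=
  fun f => `[< exists (m : nat) (g h : 'I_m -> A),
    (forall i, E (h i)) /\ f = \sum_(i < m) g i * h i >].

Section VanishingIdeal.
Variables (K : finFieldType) (s : nat).
Implicit Type Y : {set {set 'rV[K]_s}}.

Definition vanishes_on (f : {mpoly K[s]}) Y : Prop :=
  forall P, P \in Y -> forall v : 'rV[K]_s, v \in P -> f.@[v 0] = 0.

Definition vanishing_forms Y : set {mpoly K[s]} :=
  [set f | (exists d : nat, f \is d.-homog) /\ vanishes_on f Y]%classic.

Definition vanishing_ideal Y : {pred {mpoly K[s]}} :=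
  ideal_gen (vanishing_forms Y).

End VanishingIdeal.

Section ToricIdeal.
Variables (K : finFieldType) (n s : nat) (G : sgraph n s).

Definition toric_ideal : {pred {mpoly K[s]}} :=
  vanishing_ideal (toric_set K G).

Lemma toric_ideal_closed : idealr_closed toric_ideal.
Proof.
split.
- apply/asboolP; exists 0%N, (fun=> 0), (fun=> 0).
  by split=> [[]//|]; rewrite big_ord0.
- apply/negP => /asboolP[m [g [h [hE /(congr1 (meval (fun=> 1)))]]]].
  rewrite meval1 raddf_sum big1 => [/eqP|i _]; first by rewrite oner_eq0.
  have [_ h0] := hE i; rewrite /= mevalM.
  pose x : 'rV[K]_n := const_mx 1.
  have -> : (h i).@[fun=> 1] = (h i).@[(edge_monomials G x) 0].
    apply: meval_eq => k; rewrite mxE big1 // => j _.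
    by rewrite mxE expr1n.
  rewrite (h0 (proj_point (edge_monomials G x))) ?mulr0 //.
    by apply: imset_f; rewrite inE; apply/forallP => j; rewrite mxE oner_eq0.
  by apply/imsetP; exists 1; rewrite ?inE ?oner_eq0 ?scale1r.
- move=> a u v /asboolP[m [g [h [hE ->]]]] /asboolP[m' [g' [h' [hE' ->]]]].
  apply/asboolP; exists (m + m')%N.
  exists (fun i => match split i with inl j => a * g j | inr j => g' j end).
  exists (fun i => match split i with inl j => h j | inr j => h' j end).
  split=> [i|]; first by case: (split i) => j; [exact: hE | exact: hE'].
  rewrite big_split_ord mulr_sumr; congr (_ + _); apply: eq_bigr => i _.
    by rewrite -[lshift _ _]/(unsplit (inl i)) unsplitK mulrA.
  by rewrite -[rshift _ _]/(unsplit (inr i)) unsplitK.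
Qed.

HB.instance Definition _ :=
  isIdealr.Build {mpoly K[s]} toric_ideal toric_ideal_closed.

End ToricIdeal.

Arguments toric_ideal : clear implicits.
Arguments toric_ideal K [n s] G.

Section QuotientModule.
Variables (K : comNzRingType) (A : comAlgType K) (I : idealr A).
Local Notation Q := {ideal_quot I}.

Definition quot_scale (a : K) (u : Q) : Q := \pi_Q (a *: repr u).

Lemma pi_scale a (f : A) : quot_scale a (\pi_Q f) = \pi_Q (a *: f).
Proof.
rewrite /quot_scale -[f in RHS]mul1r -[repr _]mul1r !scalerAl.
by rewrite [LHS]rmorphM [RHS]rmorphM /= reprK.
Qed.

Lemma quot_scaleA a b u : quot_scale a (quot_scale b u) = quot_scale (a * b) u.
Proof. by rewrite [quot_scale b u]/quot_scale pi_scale scalerA. Qed.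

Lemma quot_scale1 : left_id 1 quot_scale.
Proof. by move=> u; rewrite /quot_scale scale1r reprK. Qed.

Lemma quot_scaleDr : right_distributive quot_scale +%R.
Proof.
move=> a u v; rewrite -[u]reprK -[v]reprK -raddfD !pi_scale scalerDr.
exact: raddfD.
Qed.

Lemma quot_scaleDl u : {morph quot_scale^~ u : a b / a + b}.
Proof. by move=> a b; rewrite /quot_scale scalerDl; exact: raddfD. Qed.

HB.instance Definition _ := GRing.Zmodule_isLmodule.Build K Q
  quot_scaleA quot_scale1 quot_scaleDr quot_scaleDl.

End QuotientModule.

Definition is_basis (K : fieldType) (V : lmodType K) (U : set V) (m : nat)
    (b : 'I_m -> V) : Prop :=
  (forall i, U (b i)) /\
  (forall u, U u -> exists! c : 'rV[K]_m, u = \sum_(i < m) c 0 i *: b i).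

(* [U] is meant to be a linear subspace of [V].  Each set given to [xget] here
   and below has at most one element; the default value 0 is taken only if it
   is empty, e.g. here if [U] is not of finite dimension. *)
Definition dim_of (K : fieldType) (V : lmodType K) (U : set V) : nat :=
  xget 0%N [set m | exists b : 'I_m -> V, is_basis U b]%classic.

Definition is_prime_ideal (A : comNzRingType) (P : {pred A}) : Prop :=
  idealr_closed P /\ prime_idealr_closed P.

Definition prime_chain (A : comNzRingType) (d : nat) : Prop :=
  exists P : 'I_d.+1 -> {pred A},
    (forall i, is_prime_ideal (P i)) /\
    (forall i j : 'I_d.+1, (i < j)%N ->
       {subset P i <= P j} /\ exists2 f, f \in P j & f \notin P i).

Definition krull_dim (A : comNzRingType) : nat :=
  xget 0%N [set d | prime_chain A d /\
                    forall e, prime_chain A e -> (e <= d)%N]%classic.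

Section Invariants.
Variables (K : finFieldType) (n s : nat) (G : sgraph n s).

Local Notation S := {mpoly K[s]}.
Local Notation X := (toric_set K G).

Definition coord_ring : comNzRingType := {ideal_quot (toric_ideal K G)}.

Definition graded_part (d : nat) : set {ideal_quot (toric_ideal K G)} :=
  [set \pi_({ideal_quot (toric_ideal K G)}) f | f in
    [set f : S | f \is d.-homog]]%classic.

Definition hilbert_function (d : nat) : nat :=
  dim_of (K := K) (@graded_part d).

Definition degree : nat :=
  xget 0%N [set c | exists N : nat, forall d : nat, (N <= d)%N ->
                      hilbert_function d = c]%classic.

Definition reg_bound (p : nat) : Prop :=
  forall d : nat, (p <= d)%N -> hilbert_function d = #|X|.

Definition regularity : nat :=
  xget 0%N [set p | reg_bound p /\
                    forall p', reg_bound p' -> (p <= p')%N]%classic.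

Definition codimension : int :=
  (krull_dim S)%:Z - (krull_dim coord_ring)%:Z.

End Invariants.

(* Main.v *)
Require Import Defs.
From mathcomp Require Import all_boot all_order all_algebra.
From mathcomp Require Import boolp classical_sets mpoly ring zify.

(* Since q > 2, the characters x |-> x^{v_k} of the torus are distinct, hence
   linearly independent: the points of X span K^s. So for each point P of X
   there is a linear form which does not vanish at P and vanishes at s - 1
   other points of X; multiplying it by one linear form for each of the
   |X| - s remaining points gives a form of degree |X| - s + 1 which is
   nonzero at P only. Such forms, multiplied by powers of a variable, show
   H_X(d) = |X| for all d >= |X| - s + 1, while the codimension is at most
   s - 1.

   The bound dim K[t_1, ..., t_s] <= s: if P_0 < ... < P_d are primes and
   f_i is in P_{i+1} but not in P_i, the monomials in the f_i are linearly
   independent modulo P_0, so d <= s by counting monomials of bounded degree. *)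

Set Implicit Arguments.
Unset Strict Implicit.
Unset Printing Implicit Defensive.

Import Order.TTheory GRing.Theory Num.Theory.

Local Open Scope ring_scope.
Local Open Scope quotient_scope.

(** * Krull dimension *)

Section IdealTheory.
Variables (A : comNzRingType) (P : {pred A}).
Hypothesis idlP : idealr_closed P.

Lemma ideal0 : 0 \in P. Proof. by case: idlP. Qed.

Lemma idealMl a f : f \in P -> a * f \in P.
Proof. by case: idlP => P0 _ h fP; rewrite -[a * f]addr0; exact: h. Qed.

Lemma idealD f g : f \in P -> g \in P -> f + g \in P.
Proof. by case: idlP => _ _ h fP gP; rewrite -[f]mul1r; exact: h. Qed.

Lemma idealDl f g : f \in P -> (f + g \in P) = (g \in P).
Proof.
move=> fP; apply/idP/idP=> [fgP | gP]; last exact: idealD.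
by rewrite -[g](addKr f) -mulN1r; apply: idealD => //; exact: idealMl.
Qed.

Hypothesis prP : prime_idealr_closed P.

Lemma prime_idealX f m g : f \notin P -> f ^+ m * g \in P -> g \in P.
Proof.
move=> fNP; elim: m => [|m IHm]; first by rewrite expr0 mul1r.
by rewrite exprS -mulrA => /prP /orP[/(negP fNP)|].
Qed.

End IdealTheory.

(** Independence of the classes modulo [P], stated in [A] itself so that [P] can move along a chain
    of primes. *)
Definition indep_mod (K : fieldType) (A : comAlgType K) (P : {pred A})
    (I : finType) (b : I -> A) : Prop :=
  forall c : I -> K, \sum_i c i *: b i \in P -> forall i, c i = 0.

(** In a relation modulo [P], the lowest power of [f] that occurs factors out and cancels, since [P]
    is prime and [f] lies outside it. What remains beyond the lowest term is a multiple of [f],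
    hence in [Q], so independence modulo [Q] kills the coefficients at that power. *)
Lemma indep_mod_powers (K : fieldType) (A : comAlgType K) (P Q : {pred A})
    (f : A) (N : nat) (I : finType) (b : I -> A) :
  is_prime_ideal P -> idealr_closed Q -> {subset P <= Q} ->
  f \in Q -> f \notin P -> indep_mod Q b ->
  indep_mod P (fun u : 'I_N * I => f ^+ u.1 * b u.2).
Proof.
move=> [idlP prP] idQ sPQ fQ fNP indb c cP [j i].
pose h (j : 'I_N) := \sum_i c (j, i) *: b i.
have sumE : \sum_u c u *: (f ^+ u.1 * b u.2) = \sum_j f ^+ nat_of_ord j * h j.
  rewrite (eq_bigr (fun u : 'I_N * I => f ^+ u.1 * (c (u.1, u.2) *: b u.2)));
    last by case=> j' i' _; rewrite /= scalerAr.
  rewrite -(pair_bigA _ (fun (j : 'I_N) i => f ^+ j * (c (j, i) *: b i))) /=.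
  by apply: eq_bigr => j' _; rewrite /h mulr_sumr.
rewrite {}sumE in cP.
have: forall m (j : 'I_N), nat_of_ord j = m -> forall i, c (j, i) = 0.
  elim/ltn_ind => m IH j0 j0m; apply: indb; rewrite -/(h j0).
  (* As [h j = 0] for [j < j0], the sum is [f ^+ j0 * (h j0 + f * _)]. *)
  pose r := \sum_(j < N | (j0 < j)%N) f ^+ (j - j0.+1) * h j.
  have sumE : \sum_j f ^+ nat_of_ord j * h j = f ^+ j0 * (h j0 + f * r).
    rewrite (bigID (fun j : 'I_N => j < j0)%N) /= big1 ?add0r; last first.
      move=> j' lt_j'; rewrite /h big1 ?mulr0 // => i' _.
      by rewrite (IH j') ?scale0r // -j0m.
    rewrite (bigD1 j0) -?leqNgt //= mulrDr; congr (_ + _).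
    rewrite mulrA -exprSr mulr_sumr; apply: eq_big => [j'|j' lt_j].
      by rewrite -leqNgt [RHS]ltn_neqAle eq_sym andbC.
    rewrite mulrA -exprD subnKC // ltn_neqAle.
    by move: lt_j; rewrite -leqNgt andbC eq_sym.
  have: h j0 + f * r \in P by move: cP; rewrite sumE => /(prime_idealX prP fNP).
  by move/sPQ; rewrite addrC idealDl // mulrC idealMl.
by move=> /(_ _ j erefl i).
Qed.

(** * Upper bound for the dimension of a polynomial ring *)

Section KrullMpoly.
Variables (K : fieldType) (s : nat).
Local Notation S := {mpoly K[s]}.

Lemma msizeXM_le (f g : S) m : (msize (f ^+ m * g) <= m * msize f + msize g)%N.
Proof.
elim: m => [|m IHm]; first by rewrite expr0 mul1r.
rewrite exprS -mulrA mulSn -addnA.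
have [->|f0] := eqVneq f 0; first by rewrite mul0r msize0.
have [->|h0] := eqVneq (f ^+ m * g) 0; first by rewrite mulr0 msize0.
by rewrite msizeM // (leq_trans (leq_pred _)) // leq_add2l.
Qed.

(** The family consists of the monomials in the [f i] with exponents below [N]. It is built from the
    top of the chain, where [1] alone is independent because a prime ideal is proper; each step down
    adds the powers of one more [f i]. *)
Lemma indep_mod_chain (d : nat) (P : nat -> {pred S}) (f : nat -> S) D N :
  (forall i, (i <= d)%N -> is_prime_ideal (P i)) ->
  (forall i, (i < d)%N -> {subset P i <= P i.+1}) ->
  (forall i, (i < d)%N -> f i \in P i.+1) ->
  (forall i, (i < d)%N -> f i \notin P i) ->
  (forall i, (i < d)%N -> (msize (f i) <= D)%N) ->
  exists (I : finType) (b : I -> S),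
    [/\ #|I| = (N ^ d)%N, indep_mod (P 0%N) b
      & forall i, (msize (b i) <= d * N * D + 1)%N].
Proof.
elim: d P f => [|d IHd] P f prP sP fP fNP fD.
  exists unit, (fun=> 1); split=> [|c|i].
  - by rewrite card_unit.
  - rewrite (bigD1 tt) //= big1 ?addr0 => [cP []|[]//].
    have [idlP _] := prP 0%N (leqnn _); have [_ P1 _] := idlP.
    apply: contraNeq P1 => c0.
    have -> : 1 = (c tt)^-1%:A * (c tt *: 1) :> S.
      by rewrite -scalerAl mul1r scalerA mulVf ?scale1r.
    exact: idealMl.
  - by rewrite msize1.
have [|||||I [b [cardI indb bD]]] := IHd (P \o succn) (f \o succn).
1-5: by move=> i lti; rewrite /=; auto.
exists ('I_N * I)%type, (fun u : 'I_N * I => f 0%N ^+ u.1 * b u.2).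
split=> [||[j i] /=].
- by rewrite card_prod card_ord cardI expnS.
- have [idP1 _] := prP 1%N isT.
  by apply: indep_mod_powers indb; auto.
- apply: leq_trans (msizeXM_le _ _ _) _; rewrite !mulSn mulnDl -addnA.
  by rewrite leq_add ?bD // leq_mul ?fD // ltnW.
Qed.

Lemma card_bmultinom_le B : (#|{: 'X_{1..s < B}}| <= B ^ s)%N.
Proof.
have lt_mB (m : 'X_{1..s < B}) i : (m i < B)%N.
  apply: leq_ltn_trans (bmdeg m); rewrite mdegE.
  by rewrite (bigD1 i) //= leq_addr.
pose h m : {ffun 'I_s -> 'I_B} := [ffun i => Ordinal (lt_mB m i)].
suff inj_h : injective h.
  by rewrite (leq_trans (leq_card _ inj_h)) // card_ffun !card_ord.
move=> m m' /ffunP eq_h; apply/val_inj/mnmP => i.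
by have := eq_h i; rewrite !ffunE => /(congr1 val).
Qed.

(** As [0] lies in [P], the [b i] are independent in [S], so the matrix [M] of their coefficients
    has independent rows; its columns are the monomials of degree below [B]. *)
Lemma indep_mod_card (P : {pred S}) (I : finType) (b : I -> S) B :
  idealr_closed P -> indep_mod P b -> (forall i, (msize (b i) <= B)%N) ->
  (#|I| <= B ^ s)%N.
Proof.
move=> idP indb bB; apply: leq_trans (card_bmultinom_le B).
pose M : 'M[K]_(#|I|, #|{: 'X_{1..s < B}}|) :=
  \matrix_(i, j) (b (enum_val i))@_(enum_val j : 'X_{1..s < B}).
suff /eqnP <- : row_free M by exact: rank_leq_col.
apply: inj_row_free => v vM0; apply/rowP => i; rewrite mxE.
suff /indb/(_ (enum_val i)) : \sum_i v 0 (enum_rank i) *: b i \in P.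
  by rewrite enum_valK.
suff -> : \sum_i v 0 (enum_rank i) *: b i = 0 by exact: ideal0.
apply/mpolyP => m; rewrite mcoeff0 raddf_sum /=.
have [ltmB | leBm] := ltnP (mdeg m) B; last first.
  apply: big1 => k _; rewrite mcoeffZ memN_msupp_eq0 ?mulr0 //.
  by apply: msize_mdeg_ge; exact: leq_trans (bB k) leBm.
have := congr1 (fun w : 'rV_ _ => w 0 (enum_rank (BMultinom ltmB))) vM0.
rewrite !mxE => vMm; rewrite -[RHS]vMm.
rewrite (reindex _ (onW_bij _ (@enum_val_bij I))) /=.
by apply: eq_bigr => k _; rewrite mcoeffZ enum_valK mxE enum_rankK.
Qed.

Lemma prime_chain_mpoly_le d : prime_chain S d -> (d <= s)%N.
Proof.
move=> [P [prP ltP]]; rewrite leqNgt; apply/negP => lt_sd.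
(* The chain is reindexed by natural numbers, so that it can be shifted in the induction of
   [indep_mod_chain]. *)
pose Q i := P (inord i).
have ltQ i : (i < d)%N ->
    {subset Q i <= Q i.+1} /\ exists f, f \in Q i.+1 /\ f \notin Q i.
  move=> ltid; have [|sP [f fP fNP]] := ltP (inord i) (inord i.+1).
    by rewrite !inordK // ltnW.
  by split=> //; exists f.
have /choice[f fQ] : forall i, exists f, (i < d)%N -> f \in Q i.+1 /\ f \notin Q i.
  move=> i; have [/ltQ[_ [f ?]]|_] := ltnP i d; [by exists f | by exists 0].
pose D := \max_(i < d) msize (f i).
pose C := ((d * D + 1) ^ s)%N.
have [i _|i /ltQ[]//|i /fQ[]//|i /fQ[]//|i lti|I [b [cardI indb bB]]] :=
  @indep_mod_chain d Q f D C.+1; first exact: prP.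
  by rewrite (leq_bigmax (Ordinal lti)).
have [idQ _] : is_prime_ideal (Q 0%N) by exact: prP.
have := indep_mod_card idQ indb bB; rewrite {}cardI leqNgt => /negP; apply.
(* With [N = C.+1], the bound is at most [(N * (d * D + 1)) ^ s = N ^ s * C]. *)
apply: (@leq_ltn_trans ((C.+1 * (d * D + 1)) ^ s)%N).
  have [->//|s_gt0] := posnP s; rewrite leq_exp2r //.
  by rewrite mulnDr muln1 [(d * _)%N]mulnC -mulnA leq_add.
rewrite expnMn -/C (@leq_trans (C.+1 ^ s.+1)%N) ?leq_pexp2l //.
by rewrite expnSr ltn_pmul2l ?expn_gt0.
Qed.

End KrullMpoly.

(** * Prime chains in quotients and bounds for [krull_dim] *)

Lemma prime_chain_quot (A : comNzRingType) (I : idealr A) d :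
  prime_chain {ideal_quot I} d -> prime_chain A d.
Proof.
move=> [P [prP ltP]].
exists (fun i f => \pi_({ideal_quot I}) f \in P i); split=> [i|i j /ltP[sP [u uj ui]]].
  have [[P0 P1 PM] prPi] := prP i; split; first split.
  - by rewrite unfold_in rmorph0.
  - by rewrite unfold_in rmorph1.
  - by move=> a f g; rewrite !unfold_in rmorphD rmorphM; exact: PM.
  - by move=> f g; rewrite !unfold_in rmorphM; exact: prPi.
split=> [f|]; first exact: sP.
by exists (repr u); rewrite unfold_in /= reprK.
Qed.

Lemma krull_dim_le (A : comNzRingType) N :
  (forall e, prime_chain A e -> (e <= N)%N) -> (krull_dim A <= N)%N.
(* If there is no longest chain, the default value [0] satisfies the bound too. *)
Proof. by move=> leN; rewrite /krull_dim; case: xgetP => // d _ [/leN]. Qed.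

(** The bound [N] ensures that a longest chain exists, so [krull_dim A] is a true maximum and not
    the default value. *)
Lemma krull_dim_ge (A : comNzRingType) d N :
  prime_chain A d -> (forall e, prime_chain A e -> (e <= N)%N) ->
  (d <= krull_dim A)%N.
Proof.
move=> dA leN; rewrite /krull_dim.
suff [_] : prime_chain A (krull_dim A) /\
    forall e, prime_chain A e -> (e <= krull_dim A)%N by apply.
apply: (@xgetPex _ 0%N [set m | prime_chain A m /\ _]%classic).
have exA : exists m, `[< prime_chain A m >] by exists d; apply/asboolP.
have leA m : `[< prime_chain A m >] -> (m <= N)%N by move/asboolP/leN.
have [m /asboolP mA maxm] := ex_maxnP exA leA.
by exists m; split=> // e eA; apply: maxm; apply/asboolP.
Qed.

Section Kernel.
Variables (A : comNzRingType) (D : idomainType) (phi : {rmorphism A -> D}).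
Variable I : idealr A.
Hypothesis phiI : forall f, f \in I -> phi f = 0.

Lemma rmorph_repr_quot f : phi (repr (\pi_({ideal_quot I}) f)) = phi f.
Proof.
apply/eqP; rewrite -subr_eq0 -rmorphB phiI //.
by rewrite Quotient.idealrBE reprK.
Qed.

(** This is the kernel of the map that [phi] induces on the quotient; it is prime because [D] is a
    domain. *)
Lemma prime_ideal_kernel :
  is_prime_ideal (fun u : {ideal_quot I} => phi (repr u) == 0).
Proof.
split; first split.
- by rewrite unfold_in -(rmorph0 \pi_({ideal_quot I})) rmorph_repr_quot rmorph0.
- by rewrite unfold_in -(rmorph1 \pi_({ideal_quot I})) rmorph_repr_quot rmorph1 oner_eq0.
- move=> a u v; rewrite !unfold_in => /eqP u0 /eqP v0.
  rewrite -[a]reprK -[u]reprK -[v]reprK -rmorphM -rmorphD rmorph_repr_quot.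
  by rewrite rmorphD rmorphM u0 v0 mulr0 addr0.
- move=> u v; rewrite !unfold_in -{1}[u]reprK -{1}[v]reprK -rmorphM rmorph_repr_quot.
  by rewrite rmorphM mulf_eq0.
Qed.

End Kernel.

(** * Forms separating finitely many points *)

Section Homogeneous.
Variables (K : fieldType) (s : nat).
Local Notation S := {mpoly K[s]}.

(** The target is a general ring because [t] is later a scalar and also the variable of
    [{poly K}]. *)
Lemma mmap_homog (R : comNzRingType) (phi : {rmorphism K -> R}) (t : R)
    (h : 'I_s -> R) (d : nat) (p : S) :
  p \is d.-homog -> mmap phi (fun i => t * h i) p = t ^+ d * mmap phi h p.
Proof.
move=> /dhomogP hp; rewrite /mmap mulr_sumr big_seq [RHS]big_seq.
apply: eq_bigr => m /hp <-; rewrite mulrCA; congr (_ * _).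
rewrite /mmap1 /= mdegE expr_sum -big_split /=.
by apply: eq_bigr => i _; rewrite exprMn.
Qed.

Lemma meval_homog (a : K) (v : 'I_s -> K) (d : nat) (p : S) :
  p \is d.-homog -> p.@[fun i => a * v i] = a ^+ d * p.@[v].
Proof. exact: mmap_homog. Qed.

Lemma dhomog_prod_linear (J : finType) (A : {pred J}) (l : J -> S) :
  (forall j, j \in A -> l j \is 1.-homog) -> \prod_(j in A) l j \is #|A|.-homog.
Proof.
move=> homl; rewrite -sum1_card; elim/big_rec2: _ => [|j e p Aj homp].
  exact: dhomog1.
by apply: dhomogM; rewrite ?homl.
Qed.

Lemma dhomogXU (k : 'I_s) : ('X_k : S) \is 1.-homog.
Proof. by rewrite dhomogX /= mdeg1. Qed.

(** Non-proportional vectors have a nonzero 2 by 2 minor; expanding it along [p] gives the form. *)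
Lemma separating_linear_form (p r : 'rV[K]_s) :
  r != 0 -> (forall a, p <> a *: r) ->
  exists l : S, [/\ l \is 1.-homog, l.@[r 0] = 0 & l.@[p 0] != 0].
Proof.
move=> /rV0Pn[k rk] npr.
have /existsP[b neqb] : [exists b, r 0 k * p 0 b != r 0 b * p 0 k].
  apply: contra_notT (npr (p 0 k / r 0 k)); rewrite negb_exists => /forallP eqb.
  apply/rowP => b; rewrite mxE mulrAC mulrC; apply: (mulfI rk).
  by have /negPn/eqP -> := eqb b; rewrite mulVKf // mulrC.
exists (r 0 k *: 'X_b - r 0 b *: 'X_k); split.
- by rewrite dhomogD ?dhomogN ?dhomogZ ?dhomogXU.
- by rewrite mevalB !mevalZ !mevalXU mulrC subrr.
- by rewrite mevalB !mevalZ !mevalXU subr_eq0.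
Qed.

(** * Forms that vanish at all points but one *)

Section Points.
Variables (I : finType) (r : I -> 'rV[K]_s).
Hypothesis r_neq0 : forall i, r i != 0.
Hypothesis r_inj : forall i j a, r i = a *: r j -> i = j.
Hypothesis r_span : forall u : 'I_s -> K,
  (forall i, \sum_k u k * r i 0 k = 0) -> forall k, u k = 0.
Hypothesis s_gt0 : (0 < s)%N.

Let M : 'M[K]_(#|I|, s) := \matrix_(j, k) r (enum_val j) 0 k.

Lemma row_full_points : row_full M.
Proof.
rewrite /row_full -mxrank_tr; apply: inj_row_free => u uM0.
apply/rowP => k; rewrite mxE; apply: (r_span (u := u 0)) => j.
have := congr1 (fun w : 'rV_ _ => w 0 (enum_rank j)) uM0; rewrite !mxE => uMj.
by rewrite -[RHS]uMj; apply: eq_bigr => k' _; rewrite !mxE enum_rankK.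
Qed.

Lemma spanning_card : (s <= #|I|)%N.
Proof. by rewrite -(eqnP row_full_points) rank_leq_row. Qed.

(** Choose [s] of the points as a basis: the coordinates in it are linear forms, each vanishing at
    all basis points but one, and some coordinate of [r i] is nonzero. *)
Lemma linear_form_many_zeros i : exists (l : S) (J : {set I}),
  [/\ l \is 1.-homog, l.@[r i 0] != 0, #|J| = s.-1
    & forall j, j \in J -> l.@[r j 0] = 0].
Proof.
pose e := fullrankfun row_full_points; pose B := rowsub e M.
have unitB : B \in unitmx := fullrowsub_unit row_full_points.
have rowB k : row k B = r (enum_val (e k)).
  by apply/rowP => k'; rewrite !mxE.
have /rV0Pn[k ak] : r i *m invmx B != 0.
  by apply: contraNneq (r_neq0 i) => aB0; rewrite -(mulmxKV unitB (r i)) aB0 mul0mx.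
pose l : S := \sum_k' invmx B k' k *: 'X_k'.
have lE (v : 'rV_s) : l.@[v 0] = (v *m invmx B) 0 k.
  rewrite raddf_sum mxE; apply: eq_bigr => k' _.
  by rewrite /= mevalZ mevalXU mulrC.
exists l, [set enum_val (e k') | k' in [set~ k]]; split.
- by apply: rpred_sum => k' _; rewrite dhomogZ ?dhomogXU.
- by rewrite lE.
- rewrite card_imset ?cardsC1 ?card_ord // => k1 k2 /enum_val_inj.
  exact: fullrankfun_inj.
- move=> _ /imsetP[k' k'Nk ->]; rewrite lE -rowB -row_mul mulmxV // !mxE.
  by move: k'Nk; rewrite !inE => /negbTE ->.
Qed.

Lemma indicator_form i d : (#|I| < d + s)%N -> exists f : S,
  [/\ f \is d.-homog, f.@[r i 0] != 0 & forall j, j != i -> f.@[r j 0] = 0].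
Proof.
move=> lt_Id; have [l [J [homl li cardJ lJ]]] := linear_form_many_zeros i.
have iNJ : i \notin J by apply: contra li => /lJ ->.
have [k rik] := rV0Pn _ (r_neq0 i).
pose R := ~: (i |: J).
have cardR : (#|R| < d)%N.
  have := cardsC (i |: J); rewrite cardsU1 iNJ cardJ -/R add1n prednK // => cardI.
  by rewrite -(ltn_add2r s) addnC cardI.
have /choice[g gP] : forall j, exists g : S,
    j != i -> [/\ g \is 1.-homog, g.@[r j 0] = 0 & g.@[r i 0] != 0].
  move=> j; have [_|ji] := eqVneq j i; first by exists 0.
  have [|g gP] := @separating_linear_form (r i) (r j) (r_neq0 j); last by exists g.
  by move=> a /r_inj/esym/eqP; apply/negP.
have RNi j : j \in R -> j != i by rewrite !inE negb_or => /andP[].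
(* [l] handles the points of [J], the [g j] those of [R]; the power of ['X_k], nonzero at [r i],
   raises the degree from [#|R| + 1] to [d]. *)
exists (l * (\prod_(j in R) g j) * 'X_k ^+ (d - #|R|.+1)); split.
- rewrite -[X in X.-homog](subnKC cardR) -add1n.
  rewrite dhomogM ?dhomogM ?dhomog_prod_linear //.
    by move=> j /RNi/gP[].
  by rewrite -[X in X.-homog]mul1n dhomogMn ?dhomogXU.
- rewrite !mevalM rmorph_prod rmorphXn /= mevalXU !mulf_neq0 ?expf_neq0 //.
  by apply/prodf_neq0 => j /RNi/gP[].
- move=> j ji; rewrite !mevalM rmorph_prod /=.
  have [/lJ ->|jNJ] := boolP (j \in J); first by rewrite !mul0r.
  have Rj : j \in R by rewrite !inE negb_or ji.
  by rewrite (bigD1 j) //=; have [_ -> _] := gP j ji; rewrite !(mul0r, mulr0).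
Qed.

End Points.
End Homogeneous.

(** * The toric set of a graph *)

(** [K] being finite, cardinalities suffice: passing from coordinates in [b] to coordinates in [b']
    is injective. *)
Lemma is_basis_leq (K : finFieldType) (V : lmodType K) (U : set V) m m'
    (b : 'I_m -> V) (b' : 'I_m' -> V) :
  (forall c : 'rV[K]_m, U (\sum_i c 0 i *: b i)) ->
  is_basis U b -> is_basis U b' -> (m <= m')%N.
Proof.
move=> Ub [_ exb] [_ exb'].
have /choice[g gP] : forall c : 'rV[K]_m, exists c' : 'rV[K]_m',
    \sum_i c 0 i *: b i = \sum_i c' 0 i *: b' i.
  by move=> c; have [c' [? _]] := exb' _ (Ub c); exists c'.
have inj_g : injective g.
  move=> c d gcd; have [e [_ uniq_e]] := exb _ (Ub c).
  by rewrite -(uniq_e c) // (uniq_e d) // !gP gcd.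
have := leq_card g inj_g; rewrite !card_mx !mul1n leq_exp2l //.
exact: card_finNzRing_gt1.
Qed.

Section Toric.
Variables (K : finFieldType) (n s : nat) (G : sgraph n s).
Local Notation S := {mpoly K[s]}.
Local Notation X := (toric_set K G).
Local Notation Q := {ideal_quot (toric_ideal K G)}.

Lemma edge_monomials_neq0 (x : 'rV[K]_n) k :
  (forall i, x 0 i != 0) -> edge_monomials G x 0 k != 0.
Proof.
by move=> x0; rewrite mxE; apply/prodf_neq0 => i _; rewrite expf_neq0.
Qed.

Lemma proj_point_refl (v : 'rV[K]_s) : v \in proj_point v.
Proof. by apply/imsetP; exists 1; rewrite ?inE ?oner_eq0 ?scale1r. Qed.

Lemma proj_pointZ (a : K) (v : 'rV[K]_s) :
  a != 0 -> proj_point (a *: v) = proj_point v.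
Proof.
move=> a0; apply/setP => w; apply/imsetP/imsetP => -[c c0 ->].
  by exists (c * a); rewrite ?scalerA // inE mulf_neq0.
exists (c / a); first by rewrite inE mulf_neq0 ?invr_eq0.
by rewrite scalerA divfK.
Qed.

Hypothesis s_gt0 : (0 < s)%N.

(** The line through a vector [v] over a point of [X] gives a morphism [phi] from [S] to [{poly K}].
    The chain is the kernel of [phi], followed by that of [phi] with evaluation at [0]. *)
Lemma prime_chain_coord_ring : prime_chain (coord_ring K G) 1.
Proof.
pose v := edge_monomials G (const_mx 1 : 'rV[K]_n).
have v0 k : v 0 k != 0.
  by apply: edge_monomials_neq0 => i; rewrite mxE oner_eq0.
have vX : proj_point v \in X.
  apply: imset_f; rewrite inE; apply/forallP => i.
  by rewrite mxE oner_eq0.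
pose phi : {rmorphism S -> {poly K}} :=
  mmap (@polyC K) (fun k => 'X * (v 0 k)%:P).
have phiI f : f \in toric_ideal K G -> phi f = 0.
  move=> /asboolP[m [g [h [hP ->]]]]; rewrite raddf_sum big1 // => i _.
  (* By homogeneity, the image of a generator is ['X ^+ d] times its value at [v], which is zero. *)
  have [[d homh] h0] := hP i; rewrite /= rmorphM /= (mmap_homog _ _ _ homh).
  suff -> : mmap (@polyC K) (fun k => (v 0 k)%:P) (h i) = ((h i).@[v 0])%:P.
    by rewrite (h0 _ vX) ?proj_point_refl // !mulr0.
  rewrite /meval /mmap rmorph_sum; apply: eq_bigr => mm _ /=.
  rewrite rmorphM rmorph_prod.
  by under [X in _ = _ * X]eq_bigr do rewrite rmorphXn.
exists (fun i : 'I_2 => if i == 0%N :> nat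
  then (fun u : Q => phi (repr u) == 0)
  else (fun u : Q => (horner_eval 0 \o phi) (repr u) == 0)).
split=> [i|i j].
  case: ifP => _; first exact: prime_ideal_kernel.
  apply: (prime_ideal_kernel (phi := horner_eval 0 \o phi)) => f /phiI /= ->.
  by rewrite /horner_eval horner0.
case: i j => -[|[|//]] ? [[|[|//]] ?] //= _; split=> [u|].
  by rewrite !unfold_in /= => /eqP ->; rewrite /horner_eval horner0.
have phiX : phi 'X_(Ordinal s_gt0) = 'X * (v 0 (Ordinal s_gt0))%:P.
  by rewrite /phi /= mmapX mmap1U.
exists (\pi_Q 'X_(Ordinal s_gt0)); rewrite unfold_in rmorph_repr_quot // phiX.
  by rewrite /= /horner_eval hornerM hornerX mul0r.
by rewrite mulf_neq0 ?polyX_eq0 ?polyC_eq0.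
Qed.

Lemma codimension_le : codimension K G <= s.-1%:Z.
Proof.
have leC e : prime_chain (coord_ring K G) e -> (e <= s)%N.
  by move/prime_chain_quot/prime_chain_mpoly_le.
have := krull_dim_ge prime_chain_coord_ring leC.
have : (krull_dim S <= s)%N := krull_dim_le (@prime_chain_mpoly_le K s).
by rewrite /codimension; lia.
Qed.

Hypothesis K2 : #|K| <> 2%N.

Lemma edge_monomials_indep (u : 'I_s -> K) :
  (forall x : 'rV[K]_n, (forall i, x 0 i != 0) ->
     \sum_k u k * edge_monomials G x 0 k = 0) ->
  forall k, u k = 0.
Proof.
move=> u0 k.
(* Here [q <> 2] enters: the differences below need a value [t] of the torus other than [1]. *)
have [t t0 t1] : exists2 t : K, t != 0 & t != 1.
  have /existsP[t] : [exists t : K, t \notin [set 0; 1]].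
    apply: contra_notT K2; rewrite negb_exists => /forallP K01.
    rewrite -cardsT; transitivity #|[set 0; 1 : K]|.
      by apply: eq_card => t; rewrite [RHS](negPn (K01 t)) inE.
    by rewrite cards2 eq_sym oner_eq0.
  by rewrite !inE negb_or => /andP[]; exists t.
have /cards2P[a [b [ab Ek]]] : #|edge G k| == 2%N by rewrite edge_card2.
pose x c e : 'rV[K]_n := \row_i (if i == a then c else if i == b then e else 1).
have xE c e k' : edge_monomials G (x c e) 0 k' =
    c ^+ edge_vector G k' a * e ^+ edge_vector G k' b.
  rewrite mxE (bigD1 a) //= (bigD1 b) 1?eq_sym //= big1 ?mulr1 => [|i].
    by rewrite !mxE eqxx eq_sym (negbTE ab) eqxx.
  by case/andP=> /negbTE ia /negbTE ib; rewrite mxE ia ib expr1n.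
have u0x c e : c != 0 -> e != 0 ->
    \sum_k' u k' * (c ^+ edge_vector G k' a * e ^+ edge_vector G k' b) = 0.
  move=> c0 e0; rewrite -[RHS](u0 (x c e)) => [|i].
    by apply: eq_bigr => k' _; rewrite xE.
  by rewrite mxE; do 2?case: ifP => // _; exact: oner_neq0.
(* Second-order difference in the variables a and b: it kills every edge
   monomial but that of the edge {a, b}. *)
have : \sum_k' u k' * ((t ^+ edge_vector G k' a - 1) *
                       (t ^+ edge_vector G k' b - 1)) = 0.
  have N1 := oner_neq0 K.
  pose F c e := \sum_k' u k' * (c ^+ edge_vector G k' a * e ^+ edge_vector G k' b).
  transitivity (F t t - F t 1 - F 1 t + F 1 1); last first.
    by rewrite /F !u0x // !subr0 addr0.
  rewrite -!sumrB -big_split /=; apply: eq_bigr => k' _.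
  by rewrite !expr1n; ring.
rewrite (bigD1 k) //= big1 => [|k' k'k]; last first.
  (* A factor is [t ^+ 0 - 1 = 0] unless the edge contains both [a] and [b], and then it is the edge
     [k]. *)
  rewrite /edge_vector; case ak': (a \in _); last by rewrite subrr mul0r mulr0.
  case bk': (b \in _); last by rewrite subrr !mulr0.
  have eqE : edge G k = edge G k'.
    apply/eqP; rewrite eqEcard !edge_card2 leqnn andbT Ek.
    by apply/fintype.subsetP => i /set2P[] ->.
  by rewrite (edge_inj eqE) eqxx in k'k.
rewrite /edge_vector Ek !inE !eqxx orbT !expr1 addr0 => /eqP.
by rewrite !mulf_eq0 subr_eq0 (negbTE t1) !orbF => /eqP.
Qed.

Lemma toric_representatives : exists r : 'I_#|X| -> 'rV[K]_s,
  [/\ forall i, proj_point (r i) = enum_val i, forall i, r i != 0,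
      forall i j a, r i = a *: r j -> i = j
    & forall u : 'I_s -> K,
        (forall i, \sum_k u k * r i 0 k = 0) -> forall k, u k = 0].
Proof.
have /choice[r rP] : forall i : 'I_#|X|, exists v : 'rV[K]_s,
    proj_point v = enum_val i /\ v != 0.
  move=> i; have /imsetP[x] := enum_valP i.
  rewrite inE => /forallP x0 eqPx; exists (edge_monomials G x); split=> //.
  by apply/rV0Pn; exists (Ordinal s_gt0); exact: edge_monomials_neq0.
exists r; split=> [i|i|i j a rij|u u0]; try by case: (rP i).
  have [ri ri0] := rP i; have [rj _] := rP j; apply: enum_val_inj.
  rewrite -ri -rj rij proj_pointZ //; apply: contraNneq ri0 => a0.
  by rewrite rij a0 scale0r.
(* Every [edge_monomials G x] is a multiple of some chosen [r i], so a linear form vanishing at all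
   [r i] vanishes there. *)
apply: edge_monomials_indep => x x0.
have XP : proj_point (edge_monomials G x) \in X.
  by apply/imsetP; exists x => //; rewrite inE; apply/forallP.
have := proj_point_refl (edge_monomials G x).
rewrite -(enum_rankK_in XP XP); set i := enum_rank_in _ _.
have [<- _] := rP i => /imsetP[a _ ->].
transitivity (a * \sum_k u k * r i 0 k); last by rewrite u0 mulr0.
by rewrite mulr_sumr; apply: eq_bigr => k _; rewrite mxE mulrCA.
Qed.

Lemma vanishing_ideal_eval (f : S) P v :
  f \in toric_ideal K G -> P \in X -> v \in P -> f.@[v 0] = 0.
Proof.
move=> /asboolP[m [g [h [hP ->]]]] PX vP.
rewrite raddf_sum big1 // => i _; have [_ h0] := hP i.
by rewrite /= mevalM (h0 P) ?mulr0.
Qed.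

(** * The Hilbert function as a count of points *)

Section Representatives.
Variable r : 'I_#|X| -> 'rV[K]_s.
Hypothesis rX : forall i, proj_point (r i) = enum_val i.

(** A form vanishing at one representative vanishes at all its multiples, so it is itself one of the
    generators. *)
Lemma toric_ideal_homog (f : S) d : f \is d.-homog ->
  (f \in toric_ideal K G) = [forall i, f.@[r i 0] == 0].
Proof.
move=> homf; apply/idP/forallP => [fI i|f0].
  apply/eqP; apply: (vanishing_ideal_eval fI (enum_valP i)).
  by rewrite -rX proj_point_refl.
apply/asboolP; exists 1%N, (fun=> 1), (fun=> f).
rewrite big_ord1 mul1r; split=> // _; split; first by exists d.
move=> P PX v; rewrite -(enum_rankK_in PX PX) -rX => /imsetP[a _ ->].
set w := r _; rewrite (meval_eq _ (v2 := fun k => a * w 0 k)) => [|k].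
  by rewrite (meval_homog _ _ homf) (eqP (f0 _)) mulr0.
by rewrite mxE.
Qed.

Lemma graded_part_lin d m (b : 'I_m -> Q) (c : 'rV[K]_m) :
  (forall i, @graded_part K n s G d (b i)) ->
  @graded_part K n s G d (\sum_i c 0 i *: b i).
Proof.
move=> bG; have /choice[f fP] : forall i, exists f : S,
    f \is d.-homog /\ \pi_Q f = b i.
  by move=> i; have [f ? ?] := bG i; exists f.
exists (\sum_i c 0 i *: f i).
  by apply: rpred_sum => i _; rewrite dhomogZ //; case: (fP i).
rewrite raddf_sum /=; apply: eq_bigr => i _; have [_ <-] := fP i.
by rewrite [RHS]pi_scale.
Qed.

Lemma hilbert_function_points d :
  (forall i, exists f : S, [/\ f \is d.-homog, f.@[r i 0] != 0
     & forall j, j != i -> f.@[r j 0] = 0]) ->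
  hilbert_function K G d = #|X|.
Proof.
move=> /choice[f fP].
(* The normalized forms take the values of the Kronecker delta at the points, so the coordinates of
   a class are its values there. *)
pose e i := (f i).@[r i 0]^-1 *: f i.
have home i : e i \is d.-homog by rewrite dhomogZ //; case: (fP i).
have eE i j : (e i).@[r j 0] = (i == j)%:R.
  have [_ fi fj] := fP i; rewrite mevalZ; have [<-|ij] := eqVneq i j.
    by rewrite mulVf.
  by rewrite (fj j) ?mulr0 // eq_sym.
pose b i : Q := \pi_Q (e i).
have sum_b (c : 'rV[K]__) : \sum_i c 0 i *: b i = \pi_Q (\sum_i c 0 i *: e i).
  by rewrite raddf_sum /=; apply: eq_bigr => i _; rewrite [LHS]pi_scale.
have sum_e (c : 'rV[K]__) j : (\sum_i c 0 i *: e i).@[r j 0] = c 0 j.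
  rewrite raddf_sum (bigD1 j) //= mevalZ eE eqxx mulr1 big1 ?addr0 // => i ij.
  by rewrite /= mevalZ eE (negbTE ij) mulr0.
have basis_b : is_basis (@graded_part K n s G d) b.
  split=> [i|u [g homg <-]]; first by exists (e i); [exact: home |].
  have coordE (c : 'rV[K]__) : \pi_Q g = \sum_i c 0 i *: b i <->
      forall j, c 0 j = g.@[r j 0].
    rewrite sum_b; split=> [/eqP|eq_c]; last apply/eqP.
      rewrite -Quotient.idealrBE (toric_ideal_homog (d := d)).
        move=> /forallP eq_c j; have := eq_c j.
        by rewrite mevalB sum_e subr_eq0 => /eqP.
      by rewrite rpredB // rpred_sum // => i _; rewrite dhomogZ.
    rewrite -Quotient.idealrBE (toric_ideal_homog (d := d)).
      by apply/forallP => j; rewrite mevalB sum_e eq_c subrr.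
    by rewrite rpredB // rpred_sum // => i _; rewrite dhomogZ.
  exists (\row_j g.@[r j 0]); split; first by apply/coordE => j; rewrite mxE.
  by move=> c /coordE eq_c; apply/rowP => j; rewrite mxE eq_c.
rewrite /hilbert_function /dim_of; apply: xget_unique; first by exists b.
move=> m [b' basis_b']; apply/eqP; rewrite eqn_leq.
have [Ub _] := basis_b; have [Ub' _] := basis_b'.
by rewrite (is_basis_leq _ basis_b' basis_b) ?(is_basis_leq _ basis_b basis_b') //;
   move=> c; exact: graded_part_lin.
Qed.

End Representatives.

Lemma hilbert_function_eq d : (#|X| < d + s)%N -> hilbert_function K G d = #|X|.
Proof.
have [r [rX r_neq0 r_inj r_span]] := toric_representatives => lt_d.
apply: (hilbert_function_points rX) => i.
by apply: indicator_form; rewrite ?card_ord.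
Qed.

Lemma degreeE : degree K G = #|X|.
Proof.
have stableX d : (#|X| <= d)%N -> hilbert_function K G d = #|X|.
  by move=> led; apply: hilbert_function_eq; lia.
(* Any other eventual constant agrees with [#|X|] at a degree beyond both thresholds. *)
apply: xget_unique => [|c [N cN]]; first by exists #|X|.
by rewrite -(stableX (maxn #|X| N)) ?leq_maxl // cN ?leq_maxr.
Qed.

Lemma regularity_le : (regularity K G <= #|X|.+1 - s)%N.
Proof.
rewrite /regularity; case: xgetP => // p _ [_]; apply.
by move=> d led; apply: hilbert_function_eq; lia.
Qed.

Lemma card_toric_set_ge : (s <= #|X|)%N.
Proof.
have [r [_ _ _ r_span]] := toric_representatives.
by rewrite -[#|X|]card_ord (spanning_card r_span).
Qed.

End Toric.

Theorem corollary2p24 (K : finFieldType) (hK : #|K| <> 2%N)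
    (n s : nat) (G : sgraph n s)
    (hH : hamiltonian G) (hB : bipartite G) :
  (regularity K G)%:Z <= (degree K G)%:Z - codimension K G.
Proof.
(* The first two vertices of the Hamiltonian cycle span an edge. *)
have s_gt0 : (0 < s)%N.
  case: hH => -[|a [|b c]] [//= _ /andP[/andP[/existsP[k _] _] _] _].
  exact: leq_ltn_trans (ltn_ord k).
(* [s <= #|X|] makes the truncated difference [#|X|.+1 - s] equal to [#|X| - (s - 1)], and the
   codimension is at most [s - 1]. *)
have := card_toric_set_ge G s_gt0 hK.
have := codimension_le K G s_gt0.
have := regularity_le G s_gt0 hK; rewrite degreeE //.
lia.
Qed.
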